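(* Let $\mathsf{X}$ be a subshift over an alphabet $\mathscr{A}$, let $R$ be a nonzero commutative unital ring, and let $x,y\in\mathsf{X}$. Then the homomorphisms $\pi:\widetilde{\mathcal{A}}_R(\mathsf{X})\to\mathrm{End}_R(\mathbb{P}_{[x]})$ and $\pi:\widetilde{\mathcal{A}}_R(\mathsf{X})\to\mathrm{End}_R(\mathbb{P}_{[y]})$ (obtained by restricting the operators $\pi(\mu)$ to $\mathbb{P}_{[x]}$ and $\mathbb{P}_{[y]}$ respectively) are equivalent if and only if $[x]=[y]$.
   Context: $\mathbb{N}=\{0,1,2,\dots\}$. $\mathscr{A}$ is an arbitrary non-empty set (alphabet); $\sigma:\mathscr{A}^{\mathbb{N}}\to\mathscr{A}^{\mathbb{N}}$ is the shift $\sigma(x_1x_2x_3\dots)=x_2x_3\dots$. $\mathscr{A}^*$ is the set of finite words, including the empty word $\omega$. For $F\subseteq\mathscr{A}^*$, the subshift $\mathsf{X}=\mathsf{X}_F$ is the set of all sequences in $\mathscr{A}^{\mathbb{N}}$ no finite (contiguous) subword of which belongs to $F$. The language $\mathcal{L}_{\mathsf{X}}$ is the set of all finite words (including $\omega$) appearing in some element of $\mathsf{X}$. For $\alpha,\beta\in\mathcal{L}_{\mathsf{X}}$ let $C(\alpha,\beta)=\{\beta x\in\mathsf{X}:\alpha x\in\mathsf{X}\}$. $\mathcal{U}$ is the Boolean algebra of subsets of $\mathsf{X}$ generated by all $C(\alpha,\beta)$, $\alpha,\beta\in\mathcal{L}_{\mathsf{X}}$ (finite unions, finite intersections, complements in $\mathsf{X}$).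 The unital subshift algebra $\widetilde{\mathcal{A}}_R(\mathsf{X})$ is the universal unital $R$-algebra with generators $\{p_A:A\in\mathcal{U}\}$ and $\{s_a,s_a^*:a\in\mathscr{A}\}$ subject to: (i) $p_{\mathsf{X}}=1$, $p_{A\cap B}=p_Ap_B$, $p_{A\cup B}=p_A+p_B-p_{A\cap B}$, $p_\emptyset=0$ for all $A,B\in\mathcal{U}$; (ii) $s_as_a^*s_a=s_a$ and $s_a^*s_as_a^*=s_a^*$ for all $a\in\mathscr{A}$; (iii) $s_\beta s_\alpha^*s_\alpha s_\beta^*=p_{C(\alpha,\beta)}$ for all $\alpha,\beta\in\mathcal{L}_{\mathsf{X}}$, where $s_\omega=s_\omega^*=1$ and, for $\alpha=\alpha_1\cdots\alpha_n$, $s_\alpha=s_{\alpha_1}\cdots s_{\alpha_n}$, $s_\alpha^*=s_{\alpha_n}^*\cdots s_{\alpha_1}^*$. $\mathbb{P}$ is the free $R$-module with basis $\{\delta_x:x\in\mathsf{X}\}$. For a statement $p$, $[p]=1$ if $p$ is true and $[p]=0$ otherwise. $\pi:\widetilde{\mathcal{A}}_R(\mathsf{X})\to\mathrm{End}_R(\mathbb{P})$ is the unique $R$-algebra homomorphism with $\pi(p_A)=P_A$, $\pi(s_a)=S_a$, $\pi(s_a^* )=S_a^*$ for $A\in\mathcal{U}$, $a\in\mathscr{A}$, where for $x=x_1x_2x_3\dots\in\mathsf{X}$: $P_A(\delta_x)=[x\in A]\,\delta_x$, $S_a(\delta_x)=[ax\in\mathsf{X}]\,\delta_{ax}$, $S_a^*(\delta_x)=[x_1=a]\,\delta_{\sigma(x)}$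 (the value being $0$ when the bracket is $0$). For $x,y\in\mathsf{X}$ write $x\sim y$ if $\sigma^n(x)=\sigma^m(y)$ for some $n,m\in\mathbb{N}$; this is an equivalence relation, and the class of $x$ is also denoted $[x]$. $\mathbb{P}_{[x]}$ is the $R$-submodule of $\mathbb{P}$ generated by $\{\delta_y:y\in[x]\}$; it is invariant under $\pi(\widetilde{\mathcal{A}}_R(\mathsf{X}))$, so $\pi$ restricts to a homomorphism $\widetilde{\mathcal{A}}_R(\mathsf{X})\to\mathrm{End}_R(\mathbb{P}_{[x]})$, still denoted $\pi$. For $R$-modules $M,N$, homomorphisms $\varphi:\widetilde{\mathcal{A}}_R(\mathsf{X})\to\mathrm{End}_R(M)$ and $\phi:\widetilde{\mathcal{A}}_R(\mathsf{X})\to\mathrm{End}_R(N)$ are equivalent if there is an $R$-module isomorphism $U:M\to N$ with $U\circ\varphi(\mu)=\phi(\mu)\circ U$ for every $\mu\in\widetilde{\mathcal{A}}_R(\mathsf{X})$. *)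

(* Defs.v *)
From HB Require Import structures.
From mathcomp Require Import all_boot all_algebra.
From mathcomp Require Import finmap boolp classical_sets.
From mathcomp Require Import monalg.

Set Implicit Arguments.
Unset Strict Implicit.
Unset Printing Implicit Defensive.

Import GRing.Theory.
Local Open Scope classical_set_scope.
Local Open Scope ring_scope.
Local Open Scope quotient_scope.

(* {malg R[K]} is the free R-module on K; the basis vector of k is << k >>.
   [linext f] is the linear map with << k >> |-> f k. *)
Section LinearExtension.
Variables (R : comNzRingType) (K : choiceType) (V : lmodType R) (f : K -> V).

Definition linext (v : {malg R[K]}) : V := \sum_(k <- msupp v) v@_k *: f k.

Lemma linextEw (d : {fset K}) (v : {malg R[K]}) :
  (finmap.fsubset (msupp v) d) -> linext v = \sum_(k <- d) v@_k *: f k.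
Proof.
move=> sd; rewrite /linext (finmap.big_fset_incl _ sd) //= => k _.
by move=> /mcoeff_outdom ->; rewrite scale0r.
Qed.

Lemma linext_is_linear : linear linext.
Proof.
move=> c u v.
pose d := finmap.fsetU (msupp (c *: u + v)) (finmap.fsetU (msupp u) (msupp v)).
have s1 : finmap.fsubset (msupp (c *: u + v)) d by exact: finmap.fsubsetUl.
have s2 : finmap.fsubset (msupp u) d.
  exact/(finmap.fsubset_trans (finmap.fsubsetUl _ _))/finmap.fsubsetUr.
have s3 : finmap.fsubset (msupp v) d.
  exact/(finmap.fsubset_trans (finmap.fsubsetUr (msupp u) _))/finmap.fsubsetUr.
rewrite (linextEw s1) (linextEw s2) (linextEw s3) scaler_sumr -big_split /=.
by apply: eq_bigr => k _; rewrite mcoeffD mcoeffZ scalerDl scalerA.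
Qed.

HB.instance Definition _ :=
  GRing.isLinear.Build R {malg R[K]} V *:%R linext linext_is_linear.

Lemma linextU k : linext << k >> = f k.
Proof.
rewrite (linextEw (d := finmap.fset1 k)) ?msuppU_le //.
by rewrite finmap.big_seq_fset1 mcoeffUU scale1r.
Qed.

Lemma linextUc c k : linext << c *g k >> = c *: f k.
Proof.
rewrite (linextEw (d := finmap.fset1 k)) ?msuppU_le //.
by rewrite finmap.big_seq_fset1 mcoeffUU.
Qed.

End LinearExtension.

Section Endomorphisms.
Variables (R : comNzRingType) (M : lmodType R).

Definition endo : Type := {linear M -> M}.

HB.instance Definition _ := gen_eqMixin endo.
HB.instance Definition _ := gen_choiceMixin endo.

Definition endo_of (f : M -> M) (fL : linear f) : endo :=
  HB.pack_for {linear M -> M} f (GRing.isLinear.Build R M M *:%R f fL).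

Lemma endoP (f g : endo) : f =1 g -> f = g.
Proof.
case: f g => [f [[f1] [f2]]] [g [[g1] [g2]]] /= /funext e.
subst g; congr GRing.Linear.Pack.
by rewrite (Prop_irrelevance f1 g1) (Prop_irrelevance f2 g2).
Qed.

Fact endo0_linear : linear (fun _ : M => 0 : M).
Proof. by move=> c u v; rewrite scaler0 addr0. Qed.
Fact endo1_linear : linear (fun v : M => v).
Proof. by []. Qed.
Fact endoN_linear (f : endo) : linear (fun v => - f v).
Proof. by move=> c u v; rewrite linearP opprD scalerN. Qed.
Fact endoD_linear (f g : endo) : linear (fun v => f v + g v).
Proof. by move=> c u v; rewrite !linearP scalerDr addrACA. Qed.
Fact endoM_linear (f g : endo) : linear (fun v => f (g v)).
Proof. by move=> c u v; rewrite !linearP. Qed.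
Fact endoZ_linear (a : R) (f : endo) : linear (fun v => a *: f v).
Proof. by move=> c u v; rewrite linearP scalerDr !scalerA mulrC. Qed.

Definition endo0 := endo_of endo0_linear.
Definition endo1 := endo_of endo1_linear.
Definition endoN f := endo_of (endoN_linear f).
Definition endoD f g := endo_of (endoD_linear f g).
Definition endoM f g := endo_of (endoM_linear f g).
Definition endoZ a f := endo_of (endoZ_linear a f).

Fact endoDA : associative endoD.
Proof. by move=> f g h; apply: endoP => v /=; rewrite addrA. Qed.
Fact endoDC : commutative endoD.
Proof. by move=> f g; apply: endoP => v /=; rewrite addrC. Qed.
Fact endo0D : left_id endo0 endoD.
Proof. by move=> f; apply: endoP => v /=; rewrite add0r. Qed.
Fact endoND : left_inverse endo0 endoN endoD.
Proof. by move=> f; apply: endoP => v /=; rewrite addNr. Qed.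

HB.instance Definition _ :=
  GRing.isZmodule.Build endo endoDA endoDC endo0D endoND.

Fact endoMA : associative endoM.
Proof. by move=> f g h; apply: endoP. Qed.
Fact endo1M : left_id endo1 endoM.
Proof. by move=> f; apply: endoP. Qed.
Fact endoM1 : right_id endo1 endoM.
Proof. by move=> f; apply: endoP. Qed.
Fact endoMDl : left_distributive endoM +%R.
Proof. by move=> f g h; apply: endoP. Qed.
Fact endoMDr : right_distributive endoM +%R.
Proof. by move=> f g h; apply: endoP => v /=; rewrite linearD. Qed.

HB.instance Definition _ :=
  GRing.Zmodule_isPzRing.Build endo endoMA endo1M endoM1 endoMDl endoMDr.

Fact endoZA a b f : endoZ a (endoZ b f) = endoZ (a * b) f.
Proof. by apply: endoP => v /=; rewrite scalerA. Qed.
Fact endo1Z : left_id 1 endoZ.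
Proof. by move=> f; apply: endoP => v /=; rewrite scale1r. Qed.
Fact endoZDr : right_distributive endoZ +%R.
Proof. by move=> a f g; apply: endoP => v /=; rewrite scalerDr. Qed.
Fact endoZDl f : {morph endoZ^~ f : a b / a + b}.
Proof. by move=> a b; apply: endoP => v /=; rewrite scalerDl. Qed.

HB.instance Definition _ :=
  GRing.Zmodule_isLmodule.Build R endo endoZA endo1Z endoZDr endoZDl.

Fact endoZAl (a : R) (f g : endo) : a *: (f * g) = (a *: f) * g.
Proof. by apply: endoP. Qed.

Fact endoZAr (a : R) (f g : endo) : a *: (f * g) = f * (a *: g).
Proof. by apply: endoP => v; rewrite /= linearZ. Qed.

Lemma endo0E v : (0 : endo) v = 0. Proof. by []. Qed.
Lemma endo1E v : (1 : endo) v = v. Proof. by []. Qed.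
Lemma endoDE (f g : endo) v : (f + g) v = f v + g v. Proof. by []. Qed.
Lemma endoNE (f : endo) v : (- f) v = - f v. Proof. by []. Qed.
Lemma endoME (f g : endo) v : (f * g) v = f (g v). Proof. by []. Qed.
Lemma endoZE a (f : endo) v : (a *: f) v = a *: f v. Proof. by []. Qed.

End Endomorphisms.

(* B is an R-algebra and phi, psi are R-algebra homomorphisms in every use;
   R-linearity of phi and psi plays no role in the definition, and MathComp's
   algebra structures exclude the zero ring, which endo M may be. *)
Definition equivalent_reps (R : comNzRingType) (B : pzRingType)
    (M N : lmodType R) (phi : {rmorphism B -> endo M})
    (psi : {rmorphism B -> endo N}) : Prop :=
  exists U : {linear M -> N},
    bijective U /\ forall mu : B, U \o phi mu =1 psi mu \o U.

(* The R-algebra presented by generators I and relations u = v, (u, v) in E: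
   the quotient of the free unital algebra {malg R[{fmonom I}]} by the
   two-sided ideal generated by the differences u - v. *)
Section Presentation.
Variables (R : comNzRingType) (I : choiceType).

Definition free_alg := {malg R[{fmonom I}]}.
HB.instance Definition _ := GRing.Lalgebra.on free_alg.

Definition free_gen (i : I) : free_alg := << fmu i >>.

Definition two_sided_ideal (J : set free_alg) : Prop :=
  [/\ J 0, forall u v, J u -> J v -> J (u + v)
    & forall a u b, J u -> J (a * u * b)].

Variable E : free_alg -> free_alg -> Prop.

Definition rel_ideal : set free_alg :=
  smallest two_sided_ideal [set w | exists u v, E u v /\ w = u - v].

Lemma rel_idealP : two_sided_ideal rel_ideal.
Proof.
split=> [J [[]]//|u v Ju Jv J JE|a u b Ju J JE]; have [[J0 JD JM] _] := JE.
  by apply: JD; [exact: Ju|exact: Jv].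
by apply: JM; exact: Ju.
Qed.

Definition in_rel_ideal : {pred free_alg} := fun w => `[< rel_ideal w >].

Fact rel_ideal_zmod : zmod_closed in_rel_ideal.
Proof.
have [J0 JD JM] := rel_idealP; split=> [|u v /asboolP Ju /asboolP Jv].
  exact/asboolP.
apply/asboolP; apply: (JD u (- v)) => //.
by move: (JM (-1) v 1 Jv); rewrite mulr1 mulN1r; apply.
Qed.

HB.instance Definition _ :=
  GRing.isZmodClosed.Build free_alg in_rel_ideal rel_ideal_zmod.

Definition palg : Type := Quotient.quot in_rel_ideal.
HB.instance Definition _ := GRing.Zmodule.on palg.
HB.instance Definition _ : EqQuotient _ (Quotient.equiv in_rel_ideal) palg := EqQuotient.on palg.

Definition pproj (u : free_alg) : palg := \pi_palg u.
Definition prepr (u : palg) : free_alg := repr u.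

Lemma preprK u : pproj (prepr u) = u.
Proof. exact: reprK. Qed.

Lemma pprojP u v : pproj u = pproj v <-> rel_ideal (u - v).
Proof.
split=> [/eqmodP/asboolP//|Juv]; apply/eqmodP; exact/asboolP.
Qed.

Lemma pproj_repr u : rel_ideal (prepr (pproj u) - u).
Proof. by apply/pprojP; rewrite preprK. Qed.

Lemma pprojD u v : pproj (u + v) = pproj u + pproj v.
Proof. exact: Quotient.pi_add. Qed.

Lemma pproj0 : pproj 0 = 0.
Proof. by apply: (addrI (pproj 0)); rewrite -pprojD !addr0. Qed.

Definition palg1 : palg := pproj 1.
Definition palgM (u v : palg) : palg := pproj (prepr u * prepr v).
Definition palgZ (c : R) (u : palg) : palg := pproj (c *: prepr u).

Lemma free_algZ (c : R) (u : free_alg) : c *: u = c%:MP * u.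
Proof. by rewrite mul_malgC. Qed.

Lemma rel_idealZ c u : rel_ideal u -> rel_ideal (c *: u).
Proof.
move=> Ju; rewrite free_algZ; have [_ _ JM] := rel_idealP.
by have := JM c%:MP u 1 Ju; rewrite mulr1.
Qed.

Lemma pprojM u v : palgM (pproj u) (pproj v) = pproj (u * v).
Proof.
have [J0 JD JM] := rel_idealP; apply/pprojP.
have telescope (a b c d : free_alg) :
    a * b - c * d = (a - c) * b + c * (b - d).
  by rewrite mulrBl mulrBr addrA subrK.
rewrite telescope; apply: JD.
  by move: (JM 1 _ (prepr (pproj v)) (pproj_repr u)); rewrite mul1r.
by move: (JM u _ 1 (pproj_repr v)); rewrite mulr1.
Qed.

Lemma pprojZ c u : palgZ c (pproj u) = pproj (c *: u).
Proof.
by apply/pprojP; move: (rel_idealZ c (pproj_repr u)); rewrite scalerBr.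
Qed.

Fact palgMA : associative palgM.
Proof.
move=> u v w; rewrite -[u]preprK -[v]preprK -[w]preprK.
by rewrite !pprojM mulrA.
Qed.
Fact palg1M : left_id palg1 palgM.
Proof. by move=> u; rewrite -[u]preprK pprojM mul1r. Qed.
Fact palgM1 : right_id palg1 palgM.
Proof. by move=> u; rewrite -[u]preprK pprojM mulr1. Qed.
Fact palgMDl : left_distributive palgM +%R.
Proof.
move=> u v w; rewrite -[u]preprK -[v]preprK -[w]preprK.
by rewrite -pprojD !pprojM mulrDl pprojD.
Qed.
Fact palgMDr : right_distributive palgM +%R.
Proof.
move=> u v w; rewrite -[u]preprK -[v]preprK -[w]preprK.
by rewrite -pprojD !pprojM mulrDr pprojD.
Qed.

HB.instance Definition _ :=
  GRing.Zmodule_isPzRing.Build palg palgMA palg1M palgM1 palgMDl palgMDr.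

Fact palgZA a b u : palgZ a (palgZ b u) = palgZ (a * b) u.
Proof. by rewrite -[u]preprK !pprojZ scalerA. Qed.
Fact palg1Z : left_id 1 palgZ.
Proof. by move=> u; rewrite -[u]preprK pprojZ scale1r. Qed.
Fact palgZDr : right_distributive palgZ +%R.
Proof.
move=> a u v; rewrite -[u]preprK -[v]preprK.
by rewrite -pprojD !pprojZ scalerDr pprojD.
Qed.
Fact palgZDl u : {morph palgZ^~ u : a b / a + b}.
Proof. by move=> a b; rewrite -[u]preprK !pprojZ scalerDl pprojD. Qed.

HB.instance Definition _ :=
  GRing.Zmodule_isLmodule.Build R palg palgZA palg1Z palgZDr palgZDl.

Fact palgZAl (a : R) (u v : palg) : a *: (u * v) = (a *: u) * v.
Proof.
rewrite -[u]preprK -[v]preprK.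
by rewrite /GRing.scale /GRing.mul /= !(pprojM, pprojZ) scalerAl.
Qed.

Lemma free_algZC (a : R) (u : free_alg) : u * a%:MP = a *: u.
Proof.
rewrite malgM_def malgZ_def fgmulgU; apply: eq_bigr => k _.
by rewrite mulm1 mulrC.
Qed.

Lemma free_algZAr (a : R) (u v : free_alg) : a *: (u * v) = u * (a *: v).
Proof. by rewrite [a *: v]free_algZ mulrA free_algZC scalerAl. Qed.

Fact palgZAr (a : R) (u v : palg) : a *: (u * v) = u * (a *: v).
Proof.
rewrite -[u]preprK -[v]preprK.
by rewrite /GRing.scale /GRing.mul /= !(pprojM, pprojZ) free_algZAr.
Qed.

Definition pgen (i : I) : palg := pproj (free_gen i).

End Presentation.

(* Evaluation of a presented algebra in an endomorphism algebra: when g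
   satisfies the relations, the unique homomorphism with pgen i |-> g i. *)
Section Evaluation.
Variables (R : comNzRingType) (I : choiceType) (M : lmodType R).
Variable g : I -> endo M.

Definition free_eval : free_alg R I -> endo M :=
  linext (fun m : {fmonom I} => \prod_(i <- (m : seq I)) g i).

HB.instance Definition _ := GRing.Linear.on free_eval.

Lemma free_evalU c (m : {fmonom I}) :
  free_eval << c *g m >> = c *: \prod_(i <- (m : seq I)) g i.
Proof. exact: linextUc. Qed.

Lemma free_eval_gen i : free_eval (free_gen R i) = g i.
Proof. by rewrite /free_eval /free_gen linextU fmU big_seq1. Qed.

Lemma free_eval1 : free_eval 1 = 1.
Proof.
rewrite -[1 : free_alg R I]/(@mkmalgU {fmonom I} R (@mone _) 1) /free_eval linextU.
by rewrite fm1 big_nil.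
Qed.

Lemma free_evalM u v : free_eval (u * v) = free_eval u * free_eval v.
Proof.
rewrite [in RHS](monalgE u) [in RHS](monalgE v) malgME !raddf_sum mulr_suml.
apply: eq_bigr => k _; rewrite raddf_sum mulr_sumr; apply: eq_bigr => l _.
rewrite /= !free_evalU fmM big_cat /=.
by rewrite -[in RHS]endoZAl -endoZAr scalerA.
Qed.

Variable E : free_alg R I -> free_alg R I -> Prop.
Hypothesis gE : forall u v, E u v -> free_eval u = free_eval v.

Lemma free_eval_ideal w : rel_ideal E w -> free_eval w = 0.
Proof.
move=> /(_ [set v | free_eval v = 0]); apply; split=> [|w' [u [v [Euv ->]]]]; last first.
  by rewrite /= linearB /= (gE Euv) subrr.
split=> [|u v /= u0 v0|a u b /= u0]; first exact: linear0.
  by rewrite linearD /= u0 v0 addr0.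
by rewrite !free_evalM u0 mulr0 mul0r.
Qed.

Definition palg_eval (u : palg E) : endo M := free_eval (prepr u).

Lemma palg_evalE u : palg_eval (pproj E u) = free_eval u.
Proof.
apply/eqP; rewrite -subr_eq0 -linearB /=; apply/eqP.
exact: (free_eval_ideal (@pproj_repr R I E u)).
Qed.

Lemma palg_eval_gen i : palg_eval (pgen E i) = g i.
Proof. by rewrite palg_evalE free_eval_gen. Qed.

Lemma palg_eval_linear : linear palg_eval.
Proof.
move=> c u v; rewrite -[u]preprK -[v]preprK.
by rewrite -[c *: _]/(palgZ _ _) pprojZ -pprojD !palg_evalE linearP.
Qed.

Lemma palg_eval_monoid : monoid_morphism palg_eval.
Proof.
split=> [|u v]; first by rewrite -[1]/(palg1 E) palg_evalE free_eval1.
rewrite -[u]preprK -[v]preprK -[X in palg_eval X]/(palgM _ _) pprojM.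
by rewrite !palg_evalE free_evalM.
Qed.

Lemma palg_eval_unique (phi : palg E -> endo M) :
  linear phi -> monoid_morphism phi -> (forall i, phi (pgen E i) = g i) ->
  phi =1 palg_eval.
Proof.
move=> phiL [phi1 phiM] phig u; rewrite -[u]preprK palg_evalE.
pose L : {linear palg E -> endo M} :=
  HB.pack phi (GRing.isLinear.Build R (palg E) (endo M) *:%R phi phiL).
have phiZ c w : phi (pproj E (c *: w)) = c *: phi (pproj E w).
  by rewrite -pprojZ -[palgZ _ _]/(c *: pproj E w); exact: (linearZZ L).
have phiS s (w : {fmonom I} -> free_alg R I) :
    phi (pproj E (\sum_(k <- s) w k)) = \sum_(k <- s) phi (pproj E (w k)).
  rewrite -[phi]/(L : _ -> _) -raddf_sum; congr (L _).
  by apply: (big_morph (pproj E)); [exact: pprojD|exact: pproj0].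
rewrite (monalgE (prepr u)) phiS raddf_sum /=; apply: eq_bigr => k _.
rewrite free_evalU.
have -> : << (prepr u)@_k *g k >> = (prepr u)@_k *: << k >> :> free_alg R I.
  by apply/malgP => l; rewrite mcoeffZ !mcoeffU mulr_natr.
rewrite phiZ; congr (_ *: _).
case: k => s; elim: s => [|i s IHs].
  rewrite big_nil -phi1; congr (phi (pproj _ _)).
  by rewrite -fmoneE.
rewrite big_cons -phig -IHs -phiM; congr phi.
rewrite -[RHS]/(palgM _ _) pprojM; congr (pproj E _).
rewrite malgM_def fgmulUU mulr1; congr (mkmalgU _ 1).
by apply/eqP; rewrite fmP fmM fmU.
Qed.

End Evaluation.

Section Subshift.
Variables (A : pointedType) (F : set (seq A)).
Implicit Types (a : A) (w alpha beta : seq A) (z : nat -> A).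

(* The sequence x_1 x_2 x_3 ... is the function n |-> x_(n+1). *)
Definition shift_seq z : nat -> A := fun n => z n.+1.
Definition cons_seq a z : nat -> A := fun n => if n is m.+1 then z m else a.
Definition cat_seq w z : nat -> A := foldr cons_seq z w.

Definition subword w z : Prop := exists i, w = [seq z j | j <- iota i (size w)].

Definition subshift : set (nat -> A) :=
  [set z | forall w, subword w z -> ~ F w].

Definition language : set (seq A) :=
  [set w | exists2 z, subshift z & subword w z].

Lemma subshift_shift z : subshift z -> subshift (shift_seq z).
Proof.
move=> Xz w [i e]; apply: Xz; exists i.+1.
by rewrite [LHS]e -addn1 addnC iotaDl -map_comp.
Qed.

Lemma subshift_tail w z : subshift (cat_seq w z) -> subshift z.
Proof. by elim: w => //= a w IHw /subshift_shift. Qed.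

Definition X : Type := set_type subshift.
HB.instance Definition _ := Choice.on X.
Implicit Types x y : X.

Definition seq_of x : nat -> A := val x.

Lemma seq_ofP x : subshift (seq_of x).
Proof. exact/set_mem/(valP x). Qed.

Definition mkX z (Xz : subshift z) : X := exist _ z (mem_set Xz).

(* sigma restricted to the shift-invariant set X. *)
Definition sigma x : X := mkX (subshift_shift (@seq_ofP x)).

Definition C_set alpha beta : set X :=
  [set y | exists z, seq_of y = cat_seq beta z /\ subshift (cat_seq alpha z)].

Definition boolean_algebra (G : set (set X)) : Prop :=
  [/\ G setT, forall B, G B -> G (~` B),
      forall B D, G B -> G D -> G (B `|` D)
    & forall B D, G B -> G D -> G (B `&` D)].

Definition U_alg : set (set X) :=
  smallest boolean_algebra
    [set B | exists alpha beta,
       [/\ language alpha, language beta & B = C_set alpha beta]].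

Inductive sgen : Type :=
  | GenP of set_type U_alg
  | GenS of A
  | GenSstar of A.

HB.instance Definition _ := gen_eqMixin sgen.
HB.instance Definition _ := gen_choiceMixin sgen.

Definition tail_equiv x y : Prop := exists n m, iter n sigma x = iter m sigma y.

Definition tail_class x : set X := [set y | tail_equiv x y].

Section Algebra.
Variable R : comNzRingType.

Local Notation FA := (free_alg R sgen).

Definition fp (B : set_type U_alg) : FA := free_gen R (GenP B).
Definition fs a : FA := free_gen R (GenS a).
Definition fs_star a : FA := free_gen R (GenSstar a).
Definition fsw w : FA := \prod_(a <- w) fs a.
Definition fsw_star w : FA := \prod_(a <- rev w) fs_star a.

Inductive subshift_rel : FA -> FA -> Prop :=
  | rel_pT B : val B = setT -> subshift_rel (fp B) 1
  | rel_p0 B : val B = set0 -> subshift_rel (fp B) 0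
  | rel_pI B D BD : val BD = val B `&` val D ->
      subshift_rel (fp BD) (fp B * fp D)
  | rel_pU B D BuD BiD : val BuD = val B `|` val D -> val BiD = val B `&` val D ->
      subshift_rel (fp BuD) (fp B + fp D - fp BiD)
  | rel_s a : subshift_rel (fs a * fs_star a * fs a) (fs a)
  | rel_s_star a :
      subshift_rel (fs_star a * fs a * fs_star a) (fs_star a)
  | rel_C alpha beta B : language alpha -> language beta ->
      val B = C_set alpha beta ->
      subshift_rel (fsw beta * fsw_star alpha * fsw alpha * fsw_star beta)
                   (fp B).

Definition subshift_algebra : Type := palg subshift_rel.
HB.instance Definition _ := GRing.PzRing.on subshift_algebra.
HB.instance Definition _ := GRing.Lmodule.on subshift_algebra.

Definition p_ (B : set_type U_alg) : subshift_algebra :=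
  pgen subshift_rel (GenP B).
Definition s_ a : subshift_algebra := pgen subshift_rel (GenS a).
Definition s_star a : subshift_algebra := pgen subshift_rel (GenSstar a).

Definition PP : Type := {malg R[X]}.
HB.instance Definition _ := GRing.Lmodule.on PP.

Definition delta x : PP := << x >>.

(* delta_z for z in X, and 0 when the sequence z is not in X. *)
Definition delta0 z : PP := oapp delta 0 (insub z).

Definition opP (B : set X) : endo PP :=
  (linext (fun x => if `[< B x >] then delta x else 0) : {linear PP -> PP}).

Definition opS a : endo PP :=
  (linext (fun x => delta0 (cons_seq a (seq_of x))) : {linear PP -> PP}).

Definition opS_star a : endo PP :=
  (linext (fun x => if seq_of x 0%N == a then delta (sigma x) else 0)
     : {linear PP -> PP}).

Definition op (i : sgen) : endo PP :=
  match i with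
  | GenP B => opP (val B)
  | GenS a => opS a
  | GenSstar a => opS_star a
  end.

Lemma delta_ext (f g : endo PP) :
  (forall x, f (delta x) = g (delta x)) -> f = g.
Proof.
move=> fg; apply: endoP => v; rewrite (monalgE v) !raddf_sum.
apply: eq_bigr => k _.
have -> : << v@_k *g k >> = v@_k *: delta k :> PP.
  by apply/malgP => l; rewrite mcoeffZ !mcoeffU mulr_natr.
by rewrite /= !linearZ /= fg.
Qed.

Lemma opPE B x : opP B (delta x) = if `[< B x >] then delta x else 0.
Proof. exact: linextU. Qed.

Lemma opSE a x : opS a (delta x) = delta0 (cons_seq a (seq_of x)).
Proof. exact: linextU. Qed.

Lemma opS_starE a x :
  opS_star a (delta x) = if seq_of x 0%N == a then delta (sigma x) else 0.
Proof. exact: linextU. Qed.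

Definition opSw w : endo PP := \prod_(a <- w) opS a.
Definition opSw_star w : endo PP := \prod_(a <- rev w) opS_star a.

Lemma delta0E x : delta0 (seq_of x) = delta x.
Proof. by rewrite /delta0 /seq_of valK. Qed.

Lemma delta0_in z (Xz : subshift z) : delta0 z = delta (mkX Xz).
Proof. exact: (delta0E (mkX Xz)). Qed.

Lemma delta0_out z : ~ subshift z -> delta0 z = 0.
Proof. by move=> nXz; rewrite /delta0 insubN //; apply/negP => /set_mem. Qed.

Lemma opS0 a z : opS a (delta0 z) = delta0 (cons_seq a z).
Proof.
have [Xz|nXz] := pselect (subshift z); first by rewrite (delta0_in Xz) opSE.
rewrite (delta0_out nXz) linear0 delta0_out // => Xaz; apply: nXz.
exact: (@subshift_tail [:: a]).
Qed.

Lemma opSw0 w z : opSw w (delta0 z) = delta0 (cat_seq w z).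
Proof.
elim: w => [|a w IHw]; first by rewrite /opSw big_nil.
by rewrite /opSw big_cons endoME -/(opSw w) IHw opS0.
Qed.

Lemma opSw_star_cons a w v :
  opSw_star (a :: w) v = opSw_star w (opS_star a v).
Proof. by rewrite /opSw_star rev_cons -cats1 big_cat big_seq1. Qed.

Lemma opSw_star_in w x z :
  seq_of x = cat_seq w z -> opSw_star w (delta x) = delta0 z.
Proof.
elim: w x => [|a w IHw] x /= e.
  by rewrite /opSw_star big_nil endo1E -delta0E e.
rewrite opSw_star_cons opS_starE e /= eqxx; apply: IHw.
by rewrite [LHS]/(shift_seq (seq_of x)) e.
Qed.

Lemma opSw_star_out w x :
  (forall z, seq_of x <> cat_seq w z) -> opSw_star w (delta x) = 0.
Proof.
elim: w x => [|a w IHw] x /= e; first by case: (e (seq_of x)).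
rewrite opSw_star_cons opS_starE; case: eqP => [x0|_]; last exact: linear0.
apply: IHw => z ez; apply: (e z); apply/funext => -[|n] //=.
by rewrite -ez.
Qed.

Lemma cat_seq_inj w : injective (cat_seq w).
Proof.
elim: w => //= a w IHw z z' e; apply: IHw; apply/funext => n.
by have := congr1 (fun f => f n.+1) e.
Qed.

Lemma op_rel u v : subshift_rel u v -> free_eval op u = free_eval op v.
Proof.
have evP B : free_eval op (fp B) = opP (val B) by rewrite free_eval_gen.
have evS a : free_eval op (fs a) = opS a by rewrite free_eval_gen.
have evT a : free_eval op (fs_star a) = opS_star a by rewrite free_eval_gen.
have evprod (s : seq A) (h : A -> FA) :
    free_eval op (\prod_(a <- s) h a) = \prod_(a <- s) free_eval op (h a).
  by apply: (big_morph (free_eval op)); [exact: free_evalM|exact: free_eval1].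
have evSw w : free_eval op (fsw w) = opSw w.
  by rewrite evprod; apply: eq_bigr.
have evTw w : free_eval op (fsw_star w) = opSw_star w.
  by rewrite evprod; apply: eq_bigr.
case=> [B e|B e|B D BD e|B D U I eU eI|a|a|alpha beta B _ _ e].
- rewrite evP free_eval1 e; apply: delta_ext => x.
  by rewrite opPE asboolT.
- rewrite evP linear0 e; apply: delta_ext => x.
  by rewrite opPE asboolF.
- rewrite evP free_evalM !evP e; apply: delta_ext => x.
  rewrite endoME !opPE asbool_and.
  case: (asboolP (val D x)) => _; rewrite ?andbF ?linear0 // andbT.
  by rewrite opPE.
- rewrite evP linearB linearD /= !evP eU eI; apply: delta_ext => x.
  rewrite !(endoDE, endoNE) !opPE asbool_or asbool_and.
  case: (asboolP (val B x)) => _; case: (asboolP (val D x)) => _ /=.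
  + by rewrite addrK.
  + by rewrite addr0 subr0.
  + by rewrite add0r subr0.
  + by rewrite addr0 subr0.
- rewrite !free_evalM !evS !evT; apply: delta_ext => x.
  rewrite !endoME !opSE.
  have [Xax|nXax] := pselect (subshift (cons_seq a (seq_of x))).
    rewrite (delta0_in Xax) opS_starE /= eqxx opSE -(delta0_in Xax).
    by congr (delta0 (cons_seq a _)).
  by rewrite (delta0_out nXax) !linear0.
- rewrite !free_evalM !evS !evT; apply: delta_ext => x.
  rewrite !endoME opS_starE; case: eqP => [x0|_]; last by rewrite !linear0.
  rewrite opSE.
  have -> : cons_seq a (seq_of (sigma x)) = seq_of x.
    by apply/funext => -[|n].
  by rewrite delta0E opS_starE x0 eqxx.
- rewrite evP !free_evalM !evSw !evTw; apply: delta_ext => x.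
  rewrite !endoME opPE e.
  have [[z xz]|nx] := pselect (exists z, seq_of x = cat_seq beta z); last first.
    rewrite opSw_star_out; last by move=> z xz; apply: nx; exists z.
    rewrite !linear0 asboolF // => -[z [xz _]]; by apply: nx; exists z.
  rewrite (opSw_star_in xz) opSw0.
  have [Xaz|nXaz] := pselect (subshift (cat_seq alpha z)).
    rewrite (delta0_in Xaz) (@opSw_star_in alpha _ z) // opSw0 -xz delta0E.
    by rewrite asboolT //; exists z.
  rewrite (delta0_out nXaz) !linear0 asboolF // => -[z' [xz' Xaz']].
  by apply: nXaz; rewrite (cat_seq_inj (etrans (esym xz) xz')).
Qed.

(* The homomorphism pi; [pi_p], [pi_s] and [pi_s_star] are its defining
   properties, and [pi_unique] says that they determine it. *)
Definition pi : subshift_algebra -> endo PP := palg_eval op (E := subshift_rel).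

Fact pi_linear : linear pi.
Proof. exact: (palg_eval_linear op_rel). Qed.
Fact pi_monoid : monoid_morphism pi.
Proof. exact: (palg_eval_monoid op_rel). Qed.

HB.instance Definition _ :=
  GRing.isLinear.Build R subshift_algebra (endo PP) *:%R pi pi_linear.
HB.instance Definition _ :=
  GRing.isMonoidMorphism.Build subshift_algebra (endo PP) pi pi_monoid.

Lemma pi_p B : pi (p_ B) = opP (val B).
Proof. exact: (palg_eval_gen op_rel (GenP B)). Qed.
Lemma pi_s a : pi (s_ a) = opS a.
Proof. exact: (palg_eval_gen op_rel (GenS a)). Qed.
Lemma pi_s_star a : pi (s_star a) = opS_star a.
Proof. exact: (palg_eval_gen op_rel (GenSstar a)). Qed.

Lemma pi_unique (phi : subshift_algebra -> endo PP) :
  linear phi -> monoid_morphism phi ->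
  (forall B, phi (p_ B) = opP (val B)) -> (forall a, phi (s_ a) = opS a) ->
  (forall a, phi (s_star a) = opS_star a) -> phi =1 pi.
Proof.
move=> phiL phiM hP hS hT.
by apply: (palg_eval_unique op_rel phiL phiM) => -[B|a|a];
  [exact: hP|exact: hS|exact: hT].
Qed.

(* P_[x] is the submodule generated by the delta_y with y in [x]. *)
Definition submodule (N : set PP) : Prop :=
  N 0 /\ forall (c : R) u v, N u -> N v -> N (c *: u + v).

Definition class_span x : set PP :=
  smallest submodule [set delta y | y in tail_class x].

Definition in_class_span x : {pred PP} := fun v => `[< class_span x v >].

Lemma class_span_delta x y : tail_equiv x y -> class_span x (delta y).
Proof. by move=> xy N [_ sN]; apply: sN; exists y. Qed.

Lemma class_spanP x : submodule (class_span x).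
Proof.
split=> [N [[]]//|c u v xu xv N NE]; have [[_ NP] _] := NE.
by apply: NP; [exact: xu|exact: xv].
Qed.

Fact in_class_span_submod x : submod_closed (in_class_span x).
Proof.
have [x0 xP] := class_spanP x; split; first exact/asboolP.
by move=> c u v /asboolP xu /asboolP xv; apply/asboolP; exact: xP.
Qed.

HB.instance Definition _ x :=
  GRing.isSubmodClosed.Build R PP (in_class_span x) (in_class_span_submod x).

(* The submodule P_[x], as an R-module in its own right. *)
Record PP_class x : Type := PPClass {
  PP_val : PP;
  PP_valP : PP_val \in in_class_span x }.

HB.instance Definition _ x := [isSub for @PP_val x].
HB.instance Definition _ x := [Choice of PP_class x by <:].
HB.instance Definition _ x := [SubChoice_isSubLmodule of PP_class x by <:].

Definition preserves x (f : endo PP) : Prop :=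
  forall v, class_span x v -> class_span x (f v).

Lemma preserves_delta x (f : endo PP) :
  (forall y, tail_equiv x y -> class_span x (f (delta y))) -> preserves x f.
Proof.
move=> xf v /(_ (fun v => class_span x (f v))); apply; split; last first.
  by move=> _ [y xy <-]; exact: xf.
have [x0 xP] := class_spanP x.
by split=> [|c u w xu xw]; rewrite ?linear0 // linearP; exact: xP.
Qed.

Lemma preserves_op x i : preserves x (op i).
Proof.
have [x0 _] := class_spanP x; apply: preserves_delta => y [n [m nm]].
case: i => [B|a|a] /=.
- rewrite opPE; case: ifP => // _; apply: class_span_delta.
  by exists n, m.
- rewrite opSE.
  have [Xay|nXay] := pselect (subshift (cons_seq a (seq_of y))); last first.
    by rewrite delta0_out.
  rewrite (delta0_in Xay); apply: class_span_delta; exists n, m.+1.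
  by rewrite nm iterSr; congr (iter m sigma _); apply: val_inj.
- rewrite opS_starE; case: ifP => // _; apply: class_span_delta.
  by exists n.+1, m; rewrite iterS nm -iterS iterSr.
Qed.

Lemma preserves_pi x mu : preserves x (pi mu).
Proof.
have [x0 xP] := class_spanP x; rewrite /pi /palg_eval.
rewrite (monalgE (prepr mu)) raddf_sum /=.
elim/big_rec: _ => [|k f _ xf]; first by move=> v _.
rewrite free_evalU => v xv; rewrite endoDE endoZE; apply: xP; last exact: xf.
elim/big_rec: _ v xv => [|i g _ xg] v xv //.
by rewrite endoME; apply: preserves_op; exact: xg.
Qed.

Fact pi_class_in x mu (v : PP_class x) : pi mu (PP_val v) \in in_class_span x.
Proof. by apply/asboolP; apply: preserves_pi; exact/asboolP/PP_valP. Qed.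

(* pi_class x mu is pi mu restricted to P_[x], see [pi_classE]. *)
Definition pi_class_fun x mu (v : PP_class x) : PP_class x :=
  PPClass (pi_class_in mu v).

Fact pi_class_fun_linear x mu : linear (@pi_class_fun x mu).
Proof. by move=> c u v; apply: val_inj; rewrite /= linearP. Qed.

Definition pi_class x mu : endo (PP_class x) :=
  endo_of (@pi_class_fun_linear x mu).

Lemma pi_classE x mu v : PP_val (pi_class x mu v) = pi mu (PP_val v).
Proof. by []. Qed.

Fact pi_class_linear x : linear (pi_class x).
Proof.
by move=> c mu nu; apply: endoP => v; apply: val_inj; rewrite /= linearP.
Qed.
Fact pi_class_monoid x : monoid_morphism (pi_class x).
Proof.
split=> [|mu nu]; apply: endoP => v; apply: val_inj => /=.
  by rewrite rmorph1.
by rewrite rmorphM.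
Qed.

HB.instance Definition _ x :=
  GRing.isLinear.Build R subshift_algebra (endo (PP_class x)) *:%R (pi_class x)
    (@pi_class_linear x).
HB.instance Definition _ x :=
  GRing.isMonoidMorphism.Build subshift_algebra (endo (PP_class x)) (pi_class x)
    (@pi_class_monoid x).

End Algebra.

Lemma tail_equiv_refl x : tail_equiv x x.
Proof. by exists 0%N, 0%N. Qed.

Lemma tail_equiv_sym x y : tail_equiv x y -> tail_equiv y x.
Proof. by move=> [n [m e]]; exists m, n. Qed.

Lemma tail_equiv_trans y x x' :
  tail_equiv x y -> tail_equiv y x' -> tail_equiv x x'.
Proof.
move=> [n [m e]] [k [l e']]; exists (k + n)%N, (m + l)%N.
by rewrite !iterD e -e' -!iterD addnC.
Qed.

End Subshift.

Arguments pi_class {A F} R x mu.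

(* Main.v *)
Require Import Defs.
From mathcomp Require Import all_boot all_algebra.
From mathcomp Require Import classical_sets.
From HB Require Import structures.
From mathcomp Require Import boolp monalg.

(** The cylinder of a prefix [w] of [x] is [C(omega, w)], so its projection
    belongs to the algebra.  An intertwiner [U : P_[x] -> P_[y]] commutes with
    these projections, all of which fix [delta_x]; hence [U delta_x] is supported
    on the sequences sharing every prefix of [x], i.e. on [x] alone.  As
    [U delta_x] is nonzero and supported in [[y]], [x] lies in [[y]]. *)

Set Implicit Arguments.
Unset Strict Implicit.
Unset Printing Implicit Defensive.

Import GRing.Theory.
Local Open Scope classical_set_scope.
Local Open Scope ring_scope.

Section TailClasses.
Variables (A : pointedType) (F : set (seq A)).
Implicit Types (x y k : X F) (w : seq A) (z : nat -> A) (n : nat).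

Lemma cat_seq_prefix n z : cat_seq (mkseq z n) (fun i => z (n + i)%N) = z.
Proof.
rewrite /mkseq; elim: n z => [|n IHn] z //=; apply/funext => -[|i] //=.
(* Position [i.+1] for [z] is position [i] for the shifted sequence, once [iota 1 n] is read as
   [iota 0 n] moved up by one. *)
have /= e := congr1 (@^~ i) (IHn (fun j => z j.+1)).
rewrite -[1%N]/(1 + 0)%N iotaDl -map_comp.
exact: e.
Qed.

Lemma cat_seq_nth a w z i : (i < size w)%N -> cat_seq w z i = nth a w i.
Proof. by elim: w i => [|b w IHw] [|i] //=; rewrite ltnS => /IHw. Qed.

Lemma language_prefix n x : language F (mkseq (seq_of x) n).
Proof.
exists (seq_of x); first exact: seq_ofP.
by exists 0%N; rewrite size_mkseq.
Qed.

(** A point [x] has to be supplied: an empty subshift has an empty language, without even the empty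
    word. *)
Lemma language_nil x : language F [::].
Proof. exact: (language_prefix 0%N x). Qed.

Lemma U_alg_cylinder n x : U_alg (@C_set A F [::] (mkseq (seq_of x) n)).
Proof.
move=> G [_]; apply; exists [::], (mkseq (seq_of x) n).
by split; [exact: (language_nil x)|exact: language_prefix|].
Qed.

Lemma cylinder_refl n x : C_set [::] (mkseq (seq_of x) n) x.
Proof.
exists (fun i => seq_of x (n + i)%N); rewrite cat_seq_prefix; split=> //=.
(* With [alpha] empty, what remains is that the tail of [x] lies in the subshift, which is
   shift-invariant. *)
by apply: (@subshift_tail _ _ (mkseq (seq_of x) n)); rewrite cat_seq_prefix;
  exact: seq_ofP.
Qed.

Lemma eq_cylinders x k :
  (forall n, C_set [::] (mkseq (seq_of x) n) k) -> k = x.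
Proof.
move=> kx; apply: val_inj; apply/funext => n.
(* Length [n.+1] is the least for which the prefix contains the entry of index [n]; [point] is only
   the default of [nth]. *)
have [z [kz _]] := kx n.+1.
rewrite -[LHS]/(seq_of k n) kz (cat_seq_nth point) ?size_mkseq //.
by rewrite nth_mkseq.
Qed.

Section Coefficients.
Variable R : comNzRingType.

Lemma mcoeff_delta x k : (delta R x)@_k = (x == k)%:R.
Proof. exact: mcoeffU. Qed.

(** The coefficient at [x] is 1, which differs from 0 because [R] is a nonzero ring. *)
Lemma delta_neq0 x : delta R x <> 0.
Proof.
move=> /(congr1 (fun v : {malg R[X F]} => v@_x)).
by rewrite mcoeff_delta eqxx mcoeff0 => /eqP; rewrite oner_eq0.
Qed.

Lemma mcoeff_opP (B : set (X F)) (v : PP F R) k :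
  (opP R B v)@_k = if `[< B k >] then v@_k else 0.
Proof.
rewrite [opP R B v]/(linext _ v) /linext [LHS](raddf_sum (mcoeff k)) /=.
case: asboolP => [Bk|nBk].
  (* Both sides become sums over the support of [v], equal term by term: only [l = k] can
     contribute. *)
  rewrite [in RHS](monalgE v) [RHS](raddf_sum (mcoeff k)) /=.
  apply: eq_bigr => l _; rewrite mcoeffZ mcoeffU.
  have [->|lk] := eqVneq l k; first by rewrite asboolT // mcoeff_delta eqxx mulr1.
  by case: ifP => _; rewrite ?mcoeff0 ?mulr0 // mcoeff_delta (negbTE lk) mulr0.
(* Every term vanishes: an index [l] in [B] differs from [k], and any other is killed by the
   projection. *)
rewrite big1 // => l _; rewrite mcoeffZ; case: asboolP => [Bl|_]; last first.
  by rewrite mcoeff0 mulr0.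
rewrite mcoeff_delta; case: eqP => [lk|_]; last by rewrite mulr0.
by case: nBk; rewrite -lk.
Qed.

(** The vectors supported in the class of [y] form a submodule containing the generators, hence the
    whole span. *)
Lemma class_span_supp y (v : PP F R) k :
  class_span y v -> v@_k != 0 -> tail_equiv y k.
Proof.
move=> /(_ (fun v : PP F R => forall k, v@_k != 0 -> tail_equiv y k)) H.
apply: H; split=> [|_ [z yz <-] l]; last first.
  by rewrite mcoeff_delta; have [<-|_] := eqVneq z l; rewrite ?eqxx.
split=> [l|c u w uy wy l]; first by rewrite mcoeff0 eqxx.
rewrite mcoeffD mcoeffZ.
have [/eqP ul0|/uy //] := boolP (u@_l == 0).
by rewrite ul0 mulr0 add0r => /wy.
Qed.

End Coefficients.

Lemma tail_class_eqP x y : tail_class x = tail_class y <-> tail_equiv y x.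
Proof.
split=> [e|yx].
  by rewrite -[tail_equiv y x]/(tail_class y x) -e; exact: tail_equiv_refl.
apply/seteqP; split=> z; first exact: tail_equiv_trans yx.
exact: tail_equiv_trans (tail_equiv_sym yx).
Qed.

Lemma equivalent_tail_equiv (R : comNzRingType) x y :
  equivalent_reps (pi_class R x) (pi_class R y) -> tail_equiv y x.
Proof.
move=> [U [Ubij UE]].
have dx : delta R x \in in_class_span x.
  by apply/asboolP; exact: class_span_delta (tail_equiv_refl x).
pose d := PPClass dx; pose v : PP F R := PP_val (U d).
have vB n : opP R (@C_set A F [::] (mkseq (seq_of x) n)) v = v.
  pose B : set_type (@U_alg A F) :=
    exist (fun D => D \in @U_alg A F) _ (mem_set (@U_alg_cylinder n x)).
  have pd : pi_class R x (p_ R B) d = d.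
    apply: val_inj; rewrite /= pi_p opPE asboolT //; exact: cylinder_refl.
  have : U (pi_class R x (p_ R B) d) = pi_class R y (p_ R B) (U d) := UE _ d.
  by rewrite pd => /(congr1 (@PP_val _ _ _ _)); rewrite pi_classE pi_p.
have vx k : v@_k != 0 -> k = x.
  move=> vk; apply: eq_cylinders => n; apply/asboolP.
  by move: vk; rewrite -(vB n) mcoeff_opP; case: ifP => //; rewrite eqxx.
suff [k vk] : exists k, v@_k != 0.
  by rewrite -(vx k vk); apply: class_span_supp vk; exact/asboolP/PP_valP.
(* If all coefficients of [v] vanished, then [U d = U 0], and injectivity of [U] would force
   [delta R x = 0]. *)
apply: contrapT => v0; apply: (@delta_neq0 R x).
have Ud0 : U d = U 0.
  rewrite linear0; apply: val_inj; apply/malgP => k; rewrite /= mcoeff0.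
  by apply/eqP; apply: contrapT => /negP vk; apply: v0; exists k.
by have /(congr1 (@PP_val _ _ _ _)) := bij_inj Ubij Ud0.
Qed.

Section Transport.
Variables (R : comNzRingType) (x y : X F) (xy : tail_class x = tail_class y).

Fact class_span_transport (v : PP_class R x) : PP_val v \in in_class_span y.
Proof.
by apply/asboolP; rewrite /class_span -xy; exact/asboolP/(PP_valP v).
Qed.

(** Equal classes span the same submodule of [PP F R], yet [PP_class R x] and [PP_class R y] are
    distinct types; this is the identity between them. *)
Definition transport (v : PP_class R x) : PP_class R y :=
  PPClass (class_span_transport v).

Fact transport_linear : linear transport.
Proof. by move=> c u v; apply: val_inj. Qed.

HB.instance Definition _ :=
  GRing.isLinear.Build R (PP_class R x) (PP_class R y) *:%R transport
    transport_linear.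

End Transport.

End TailClasses.

Theorem proposition3p12 (A : pointedType) (F : set (seq A))
    (R : comNzRingType) (x y : X F) :
  equivalent_reps (pi_class R x) (pi_class R y) <-> tail_class x = tail_class y.
Proof.
split=> [/equivalent_tail_equiv/tail_class_eqP //|xy].
exists (@transport A F R x y xy); split.
  by exists (transport (esym xy)) => v; apply: val_inj.
(* Inside [PP F R] both sides are [pi mu] applied to the same vector. *)
by move=> mu v; apply: val_inj.
Qed.
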